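(* Suppose that $F$ and $H$ satisfy the local Lipschitz conditions: for any $r>0$ there is a constant $L_r>0$ such that $\|F(x_2)-F(x_1)\|\le L_r\|x_2-x_1\|$ and $\|H(x_2)-H(x_1)\|\le L_r\|x_2-x_1\|$ whenever $\|x_1\|,\|x_2\|\le r$. Let $\varepsilon_0>0$ and $r_0\ge\|x_0,v_{1,0},\dots,v_{k,0}\|+\varepsilon_0$ be fixed, and suppose that the relaxation parameters $\beta,\gamma>0$ satisfy $$S(\beta,\gamma)\le\|x_0,v_{1,0},\dots,v_{k,0}\|+\varepsilon_0,$$ where $S$ is the function defined in the context. Then the solution $(x,v_1,\dots,v_k,l)$ on $[0,T]$ of the shrinking-dimer saddle dynamics $$\frac{dx}{dt}=\beta\Big(I-2\sum_{j=1}^kv_jv_j^\top\Big)F(x),\qquad \frac{dv_i}{dt}=\gamma\Big(I-v_iv_i^\top-2\sum_{j=1}^{i-1}v_jv_j^\top\Big)\hat H(x,v_i,l)\ (1\le i\le k),\qquad \frac{dl}{dt}=-l,$$ with initial conditions $x(0)=x_0$, $v_i(0)=v_{i,0}$ ($1\le i\le k$), $l(0)=l_0$, where $v_{i,0}^\top v_{j,0}=\delta_{i,j}$, satisfies $$\|x(t),v_1(t),\dots,v_k(t)\|\le\|x_0,v_{1,0},\dots,v_{k,0}\|+\varepsilon_0,\qquad 0\le t\le T.$$ Consequently $\|x(t)\|\le r_0$ for all $t\in[0,T]$, so that the Lipschitz conditions of $F$ and $H$ hold along the trajectory with the fixed constant $L_{r_0}$.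
   Context: Let $N,k\ge1$ be integers, $T>0$, $l_0>0$, $E:\mathbb R^N\to\mathbb R$ a twice differentiable energy function, $F(x)=-\nabla E(x)$, $H(x)=-\nabla^2E(x)$. $\|\cdot\|$ is the standard $l^2$ norm of a vector or matrix; $\|x,v_1,\dots,v_k\|:=\big(\|x\|^2+\sum_{i=1}^k\|v_i\|^2\big)^{1/2}$; $\mathcal B_r:=\{(x,v_1,\dots,v_k)\in(\mathbb R^N)^{k+1}:\|x,v_1,\dots,v_k\|\le r\}$. The dimer approximation is $$\hat H(x,v,l):=\frac{F(x+lv)-F(x-lv)}{2l},$$ and for every $r>0$ there is a constant $Q_1(r)>0$ with $\|\hat H(x,v,l)-H(x)v\|\le Q_1(r)l^2$ for all $\|x\|\le r$, $\|v\|\le r$, $0<l\le l_0$. Put $V_i(x,v_1,\dots,v_k,l):=\big(I-v_iv_i^\top-2\sum_{j=1}^{i-1}v_jv_j^\top\big)\hat H(x,v_i,l)$. Constants: $Q_0(r_0):=\sqrt{k+1}\,\max\{(1+2kr_0^2)L_{r_0},\,4r_0(\|F(0)\|+L_{r_0}r_0)\}$. $Q_2(r_0)>0$ is a fixed constant such that $$\|V_i(x,v_1,\dots,v_k,l)-V_i(\bar x,\bar v_1,\dots,\bar v_k,l)\|\le Q_2(r_0)\big(\|x-\bar x,v_1-\bar v_1,\dots,v_k-\bar v_k\|+l_0^2\big)$$ for all $1\le i\le k$, all $(x,v_1,\dots,v_k),(\bar x,\bar v_1,\dots,\bar v_k)\in\mathcal B_{r_0}$ and all $0<l\le l_0$.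 Moreover $$Q_3:=\Big(1+2k\sum_{j=1}^k\|v_{j,0}\|^2\Big)\|F(x_0)\|,$$ $$Q_4(r_0):=\Big(1+\|v_{i,0}\|^2+2k\sum_{j=1}^k\|v_{j,0}\|^2\Big)\big(\|H(x_0)\|\|v_{i,0}\|+Q_1(r_0)l_0^2\big)$$ (independent of $i$ because $\|v_{i,0}\|=1$), $$Q_5(r_0):=\beta T\big(Q_3+Q_0(r_0)r_0\big)^2+k\gamma T\big(Q_4(r_0)+Q_2(r_0)r_0+Q_2(r_0)l_0^2\big)^2,$$ $$Q_6(r_0):=\max\{\beta(1+Q_0(r_0)),\gamma(1+Q_2(r_0))\}+\beta Q_0(r_0)+k\gamma Q_2(r_0),$$ $$S(\beta,\gamma):=\big(\|x_0,v_{1,0},\dots,v_{k,0}\|^2+Q_5(r_0)\big)^{1/2}e^{Q_6(r_0)T/2}.$$ *)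

(* Defs.v *)
From HB Require Import structures.
From mathcomp Require Import all_boot all_order all_algebra.
From mathcomp Require Import all_classical all_reals all_analysis.
Import Order.TTheory GRing.Theory Num.Theory.
Import numFieldNormedType.Exports.

Set Implicit Arguments.
Unset Strict Implicit.
Unset Printing Implicit Defensive.

Local Open Scope classical_set_scope.
Local Open Scope ring_scope.

(* The library norm `|_| on matrices is the max norm: it only serves as the
   carrier of the topology and of differentiability. All quantitative bounds
   are in the Euclidean norm and the operator norm it induces. *)
Definition l2norm (R : realType) (N : nat) (u : 'cV[R]_N) : R :=
  Num.sqrt (\sum_(i < N) u i 0 ^+ 2).

Definition opnorm (R : realType) (N : nat) (A : 'M[R]_N) : R :=
  sup [set l2norm (A *m u) | u in [set u : 'cV[R]_N | l2norm u <= 1]].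

Definition state_norm (R : realType) (N k : nat)
    (x : 'cV[R]_N) (v : 'I_k -> 'cV[R]_N) : R :=
  Num.sqrt (l2norm x ^+ 2 + \sum_(i < k) l2norm (v i) ^+ 2).

Definition grad (R : realType) (N : nat) (E : 'cV[R]_N -> R)
    (x : 'cV[R]_N) : 'cV[R]_N :=
  \col_(i < N) 'D_(delta_mx i 0) E x.

Definition hessian (R : realType) (N : nat) (E : 'cV[R]_N -> R)
    (x : 'cV[R]_N) : 'M[R]_N :=
  \matrix_(i < N, j < N)
    'D_(delta_mx j 0) (fun y => 'D_(delta_mx i 0) E y) x.

Definition twice_differentiable (R : realType) (N : nat)
    (E : 'cV[R]_N -> R) : Prop :=
  (forall x, differentiable E x) /\ (forall x, differentiable (grad E) x).

Definition force (R : realType) (N : nat) (E : 'cV[R]_N -> R)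
    (x : 'cV[R]_N) : 'cV[R]_N := - grad E x.

Definition neg_hessian (R : realType) (N : nat) (E : 'cV[R]_N -> R)
    (x : 'cV[R]_N) : 'M[R]_N := - hessian E x.

Definition dimer (R : realType) (N : nat) (E : 'cV[R]_N -> R)
    (x v : 'cV[R]_N) (l : R) : 'cV[R]_N :=
  (2 * l)^-1 *: (force E (x + l *: v) - force E (x - l *: v)).

Definition x_field (R : realType) (N k : nat) (E : 'cV[R]_N -> R)
    (x : 'cV[R]_N) (v : 'I_k -> 'cV[R]_N) : 'cV[R]_N :=
  (1%:M - 2 *: \sum_(j < k) v j *m (v j)^T) *m force E x.

Definition v_field (R : realType) (N k : nat) (E : 'cV[R]_N -> R) (i : 'I_k)
    (x : 'cV[R]_N) (v : 'I_k -> 'cV[R]_N) (l : R) : 'cV[R]_N :=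
  (1%:M - v i *m (v i)^T - 2 *: \sum_(j < k | (j < i)%N) v j *m (v j)^T)
    *m dimer E x (v i) l.

Definition locally_lipschitz (R : realType) (N : nat) (E : 'cV[R]_N -> R)
    (L : R -> R) : Prop :=
  forall r : R, 0 < r -> 0 < L r /\
    forall x1 x2 : 'cV[R]_N, l2norm x1 <= r -> l2norm x2 <= r ->
      l2norm (force E x2 - force E x1) <= L r * l2norm (x2 - x1) /\
      opnorm (neg_hessian E x2 - neg_hessian E x1) <= L r * l2norm (x2 - x1).

Definition dimer_consistent (R : realType) (N : nat) (E : 'cV[R]_N -> R)
    (l0 : R) (Q1 : R -> R) : Prop :=
  forall r : R, 0 < r -> 0 < Q1 r /\
    forall (x v : 'cV[R]_N) (l : R),
      l2norm x <= r -> l2norm v <= r -> 0 < l -> l <= l0 ->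
      l2norm (dimer E x v l - neg_hessian E x *m v) <= Q1 r * l ^+ 2.

Definition v_field_lipschitz (R : realType) (N k : nat) (E : 'cV[R]_N -> R)
    (l0 : R) (Q2 : R -> R) (r : R) : Prop :=
  0 < Q2 r /\
  forall (i : 'I_k) (x y : 'cV[R]_N) (v w : 'I_k -> 'cV[R]_N) (l : R),
    state_norm x v <= r -> state_norm y w <= r -> 0 < l -> l <= l0 ->
    l2norm (v_field E i x v l - v_field E i y w l)
      <= Q2 r * (state_norm (x - y) (fun j => v j - w j) + l0 ^+ 2).

Definition Q0_const (R : realType) (N k : nat) (E : 'cV[R]_N -> R)
    (L : R -> R) (r : R) : R :=
  Num.sqrt k.+1%:R *
  Num.max ((1 + 2 * k%:R * r ^+ 2) * L r)
          (4 * r * (l2norm (force E 0) + L r * r)).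

Definition Q3_const (R : realType) (N k : nat) (E : 'cV[R]_N -> R)
    (x0 : 'cV[R]_N) (v0 : 'I_k -> 'cV[R]_N) : R :=
  (1 + 2 * k%:R * \sum_(j < k) l2norm (v0 j) ^+ 2) * l2norm (force E x0).

(* Depends on the index i only through l2norm (v0 i), so it is the same number
   for every i when v0 is orthonormal; likewise Q5_const and S_const below. *)
Definition Q4_const (R : realType) (N k : nat) (E : 'cV[R]_N -> R) (l0 : R)
    (Q1 : R -> R) (x0 : 'cV[R]_N) (v0 : 'I_k -> 'cV[R]_N) (i : 'I_k)
    (r : R) : R :=
  (1 + l2norm (v0 i) ^+ 2 + 2 * k%:R * \sum_(j < k) l2norm (v0 j) ^+ 2) *
  (opnorm (neg_hessian E x0) * l2norm (v0 i) + Q1 r * l0 ^+ 2).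

Definition Q5_const (R : realType) (N k : nat) (E : 'cV[R]_N -> R) (T l0 : R)
    (L Q1 Q2 : R -> R) (x0 : 'cV[R]_N) (v0 : 'I_k -> 'cV[R]_N) (i : 'I_k)
    (r beta gamma : R) : R :=
  beta * T * (Q3_const E x0 v0 + Q0_const k E L r * r) ^+ 2 +
  k%:R * gamma * T *
    (Q4_const E l0 Q1 x0 v0 i r + Q2 r * r + Q2 r * l0 ^+ 2) ^+ 2.

Definition Q6_const (R : realType) (N k : nat) (E : 'cV[R]_N -> R)
    (L Q2 : R -> R) (r beta gamma : R) : R :=
  Num.max (beta * (1 + Q0_const k E L r)) (gamma * (1 + Q2 r)) +
  beta * Q0_const k E L r + k%:R * gamma * Q2 r.

Definition S_const (R : realType) (N k : nat) (E : 'cV[R]_N -> R) (T l0 : R)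
    (L Q1 Q2 : R -> R) (x0 : 'cV[R]_N) (v0 : 'I_k -> 'cV[R]_N) (i : 'I_k)
    (r beta gamma : R) : R :=
  Num.sqrt (state_norm x0 v0 ^+ 2 +
            Q5_const E T l0 L Q1 Q2 x0 v0 i r beta gamma) *
  expR (Q6_const k E L Q2 r beta gamma * T / 2).

(* Classical solution on [0, T]: continuous up to both end points, with the
   equations holding in the interior. As the right-hand sides are continuous
   along such a trajectory, they then also hold at 0 and T with one-sided
   derivatives. *)
Definition saddle_dynamics (R : realType) (N k : nat) (E : 'cV[R]_N -> R)
    (T l0 beta gamma : R) (x0 : 'cV[R]_N) (v0 : 'I_k -> 'cV[R]_N)
    (x : R -> 'cV[R]_N) (v : R -> 'I_k -> 'cV[R]_N) (l : R -> R) : Prop :=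
  [/\ [/\ {within `[0, T], continuous x},
          forall i, {within `[0, T], continuous (fun t => v t i)} &
          {within `[0, T], continuous l}],
      [/\ x 0 = x0, forall i, v 0 i = v0 i & l 0 = l0] &
      forall t : R, 0 < t -> t < T ->
        [/\ is_derive t 1 x (beta *: x_field E (x t) (v t)),
            forall i, is_derive t 1 (fun s => v s i)
                        (gamma *: v_field E i (x t) (v t) (l t)) &
            is_derive t 1 l (- l t)]].

(* Main.v *)
Require Import Defs.
From HB Require Import structures.
From mathcomp Require Import all_boot all_order all_algebra.
From mathcomp Require Import all_classical all_reals all_analysis.
From mathcomp Require Import ring lra.
Import Order.TTheory GRing.Theory Num.Theory.
Import numFieldNormedType.Exports.

(** Let [W] be the norm of the state at time [t]. As long as [W <= r0], the position
    field is Lipschitz with constant [Q0] ([x_field_lipschitz]) and each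
    direction field is Lipschitz with constant [Q2] up to the dimer error;
    comparing with the initial state, the fields have norm at most
    [Q3 + Q0 r0 + Q0 W] and [Q4 + Q2 r0 + Q2 l0^2 + Q2 W] ([x_field_growth],
    [v_field_growth]). Pairing them with the state and using Young's
    inequality gives the energy inequality [(W^2)' <= Q6 W^2 + Q5 / T]
    ([energy_le]), and Gronwall's lemma turns it into
    [W^2 <= (W(0)^2 + Q5 t / T) exp (Q6 t)], whose value at [T] is [S^2].

    The energy inequality is known only inside the ball where the Lipschitz bounds
    apply, and that ball is what has to be established. The circularity is
    broken by a first-exit argument ([gronwall_bootstrap]): the Gronwall bound is
    strictly increasing in time and ends at [S^2], which is at most the squared
    radius, so the radius cannot be reached before the final time.

    The direction fields are controlled for dimer lengths in [(0, l0]] only; the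
    equation [l' = - l] keeps [l] there ([exp_decay_bounds]). *)

Set Implicit Arguments.
Unset Strict Implicit.
Unset Printing Implicit Defensive.

Local Open Scope classical_set_scope.
Local Open Scope ring_scope.

(** * Euclidean geometry of column vectors *)

Section Euclidean.
Context {R : realType} {N : nat}.
Implicit Types (u v w : 'cV[R]_N) (A : 'M[R]_N).

Definition dot u v : R := (u^T *m v) 0 0.

Lemma dotE u v : dot u v = \sum_(i < N) u i 0 * v i 0.
Proof. by rewrite /dot mxE; apply: eq_bigr => i _; rewrite mxE. Qed.

Lemma dotC u v : dot u v = dot v u.
Proof. by rewrite !dotE; apply: eq_bigr => i _; rewrite mulrC. Qed.

Lemma dotDl u v w : dot (u + v) w = dot u w + dot v w.
Proof. by rewrite /dot linearD mulmxDl mxE. Qed.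

Lemma dotZl a u w : dot (a *: u) w = a * dot u w.
Proof. by rewrite /dot linearZ -scalemxAl mxE. Qed.

Lemma dotDr u v w : dot w (u + v) = dot w u + dot w v.
Proof. by rewrite dotC dotDl !(dotC _ w). Qed.

Lemma dotZr a u w : dot w (a *: u) = a * dot w u.
Proof. by rewrite dotC dotZl dotC. Qed.

Lemma dotBl u v w : dot (u - v) w = dot u w - dot v w.
Proof. by rewrite dotDl -scaleN1r dotZl mulN1r. Qed.

Lemma mulmx_outer u v w : u *m v^T *m w = dot v w *: u.
Proof.
rewrite -mulmxA; apply/matrixP => i j; rewrite [j]ord1 !mxE big_ord1 mulrC.
by rewrite /dot mxE.
Qed.

Lemma l2norm_ge0 u : 0 <= l2norm u.
Proof. exact: sqrtr_ge0. Qed.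

Lemma sqr_l2norm u : l2norm u ^+ 2 = dot u u.
Proof.
rewrite sqr_sqrtr ?dotE; first by apply: eq_bigr => i _; rewrite expr2.
by apply: sumr_ge0 => i _; exact: sqr_ge0.
Qed.

Lemma l2norm_eq0 u : (l2norm u == 0) = (u == 0).
Proof.
have -> : (l2norm u == 0) = (dot u u == 0) by rewrite -sqr_l2norm expf_eq0.
rewrite dotE psumr_eq0; last first.
  by move=> i _; rewrite -expr2 sqr_ge0.
apply/allP/eqP => [h|-> i _]; last by rewrite /= !mxE mul0r.
apply/matrixP => i j; rewrite [j]ord1 mxE; apply/eqP.
by have := h i (mem_index_enum i); rewrite /= mulf_eq0 orbb.
Qed.

Lemma l2normZ a u : l2norm (a *: u) = `|a| * l2norm u.
Proof.
apply/eqP; rewrite -(@eqrXn2 _ 2) ?mulr_ge0 ?l2norm_ge0 //.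
by rewrite exprMn !sqr_l2norm dotZl dotZr real_normK ?num_real // mulrA expr2.
Qed.

Lemma l2normN u : l2norm (- u) = l2norm u.
Proof. by rewrite -scaleN1r l2normZ normrN1 mul1r. Qed.

(** Expand the nonnegative square of [|v|^2 u - <u, v> v], which is [|v|^2] times
    the residual of the projection of [u] on the line of [v]. *)
Lemma ler_norm_dot u v : `|dot u v| <= l2norm u * l2norm v.
Proof.
have [/eqP|v0] := eqVneq (l2norm v) 0.
  rewrite l2norm_eq0 => /eqP ->.
  by rewrite -(scale0r 0) dotZr mul0r normr0 mulr_ge0 // l2norm_ge0.
rewrite -(@ler_pXn2r _ 2) ?nnegrE ?mulr_ge0 ?l2norm_ge0 ?normr_ge0 //.
have vgt0 : 0 < l2norm v ^+ 2 by rewrite exprn_gt0 // lt0r v0 l2norm_ge0.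
rewrite -(ler_pM2l vgt0) real_normK ?num_real //.
have := sqr_ge0 (l2norm ((l2norm v ^+ 2) *: u - dot u v *: v)).
rewrite (sqr_l2norm (_ - _)) -scaleNr dotDl !dotDr !dotZl !dotZr -!sqr_l2norm.
by rewrite (dotC v u); nra.
Qed.

Lemma ler_dot u v : dot u v <= l2norm u * l2norm v.
Proof. exact: le_trans (ler_norm _) (ler_norm_dot _ _). Qed.

Lemma ler_l2normD u v : l2norm (u + v) <= l2norm u + l2norm v.
Proof.
rewrite -(@ler_pXn2r _ 2) ?nnegrE ?addr_ge0 ?l2norm_ge0 //.
rewrite sqr_l2norm dotDl !dotDr -!sqr_l2norm (dotC v u).
have := ler_dot u v; nra.
Qed.

Lemma ler_l2normB u v : l2norm (u - v) <= l2norm u + l2norm v.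
Proof. by rewrite -(l2normN v) ler_l2normD. Qed.

Lemma l2norm0 : l2norm (0 : 'cV[R]_N) = 0.
Proof. by apply/eqP; rewrite l2norm_eq0. Qed.

Lemma ler_l2norm_sum (I : finType) (P : pred I) (f : I -> 'cV[R]_N) :
  l2norm (\sum_(i | P i) f i) <= \sum_(i | P i) l2norm (f i).
Proof.
elim/big_ind2 : _ => //; first by rewrite l2norm0.
by move=> x a y b xa yb; exact: le_trans (ler_l2normD _ _) (lerD xa yb).
Qed.

Lemma ler_entry_l2norm u i : `|u i 0| <= l2norm u.
Proof.
rewrite -(@ler_pXn2r _ 2) ?nnegrE ?l2norm_ge0 ?normr_ge0 //.
rewrite real_normK ?num_real // sqr_l2norm dotE (bigD1 i) //= -expr2 lerDl.
by apply: sumr_ge0 => j _; rewrite -expr2 sqr_ge0.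
Qed.

(** The supremum defining [opnorm] is over a bounded set: the entries of a
    vector of the unit ball are at most [1] in absolute value, so [A *m u] is at
    most the sum of the norms of the columns of [A]. *)
Lemma l2norm_mulmx_le_opnorm A u : l2norm (A *m u) <= opnorm A * l2norm u.
Proof.
have unit w : l2norm w <= 1 -> l2norm (A *m w) <= opnorm A.
  move=> w1; apply: ub_le_sup; last by exists w.
  exists (\sum_(j < N) l2norm (col j A)) => _ [z /= z1 <-].
  have -> : A *m z = \sum_(j < N) z j 0 *: col j A.
    apply/matrixP => i j; rewrite [j]ord1 !mxE summxE.
    by apply: eq_bigr => m _; rewrite !mxE mulrC.
  apply: le_trans (ler_l2norm_sum _ _) _; apply: ler_sum => j _.
  rewrite l2normZ ler_piMl ?l2norm_ge0 //.
  exact: le_trans (ler_entry_l2norm _ _) z1.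
have [/eqP|u0] := eqVneq (l2norm u) 0.
  by rewrite l2norm_eq0 => /eqP ->; rewrite mulmx0 l2norm0 mulr0.
have ugt0 : 0 < l2norm u by rewrite lt0r u0 l2norm_ge0.
have := unit ((l2norm u)^-1 *: u).
rewrite -scalemxAr !l2normZ gtr0_norm ?invr_gt0 // mulVf // => /(_ (lexx _)).
by rewrite mulrC ler_pdivrMr.
Qed.

End Euclidean.

(** * The norm of a state *)

Section StateNorm.
Context {R : realType} {N k : nat}.
Implicit Types (x y : 'cV[R]_N) (v w : 'I_k -> 'cV[R]_N).

(** The norms of the components of a state, gathered in one column: its
    Euclidean norm is the state norm, so Minkowski and Cauchy-Schwarz for states
    follow from those for columns. *)
Definition norm_col x v : 'cV[R]_k.+1 :=
  \col_i (if unlift ord0 i is Some j then l2norm (v j) else l2norm x).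

Lemma state_normE x v : state_norm x v = l2norm (norm_col x v).
Proof.
rewrite /state_norm {3}/l2norm big_ord_recl !mxE unlift_none.
by congr (Num.sqrt (_ + _)); apply: eq_bigr => i _; rewrite mxE liftK.
Qed.

Lemma state_norm_ge0 x v : 0 <= state_norm x v.
Proof. exact: sqrtr_ge0. Qed.

Lemma sqr_state_norm x v :
  state_norm x v ^+ 2 = l2norm x ^+ 2 + \sum_(i < k) l2norm (v i) ^+ 2.
Proof.
by rewrite sqr_sqrtr // addr_ge0 ?sqr_ge0 ?sumr_ge0 // => i _; rewrite sqr_ge0.
Qed.

Lemma l2norm_pos_le_state_norm x v : l2norm x <= state_norm x v.
Proof.
rewrite -(@ler_pXn2r _ 2) ?nnegrE ?l2norm_ge0 ?state_norm_ge0 //.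
by rewrite sqr_state_norm lerDl sumr_ge0 // => i _; rewrite sqr_ge0.
Qed.

Lemma sum_sqr_le_state_norm x v :
  \sum_(i < k) l2norm (v i) ^+ 2 <= state_norm x v ^+ 2.
Proof. by rewrite sqr_state_norm lerDr sqr_ge0. Qed.

Lemma l2norm_dir_le_state_norm x v i : l2norm (v i) <= state_norm x v.
Proof.
rewrite -(@ler_pXn2r _ 2) ?nnegrE ?l2norm_ge0 ?state_norm_ge0 //.
apply: le_trans (sum_sqr_le_state_norm x v).
by rewrite (bigD1 i) //= lerDl sumr_ge0 // => j _; rewrite sqr_ge0.
Qed.

Lemma ler_state_normB x y v w :
  state_norm (x - y) (fun i => v i - w i) <= state_norm x v + state_norm y w.
Proof.
rewrite !state_normE; apply: le_trans (ler_l2normD _ _).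
rewrite /l2norm; apply: ler_wsqrtr; apply: ler_sum => i _.
rewrite !mxE; case: unliftP => [j|] _;
  by rewrite ler_pXn2r ?nnegrE ?addr_ge0 ?l2norm_ge0 ?ler_l2normB.
Qed.

Lemma sum_norm_le_state_norm x v :
  l2norm x + \sum_(i < k) l2norm (v i) <= Num.sqrt k.+1%:R * state_norm x v.
Proof.
rewrite mulrC state_normE.
have -> : Num.sqrt k.+1%:R = l2norm (const_mx 1 : 'cV[R]_k.+1).
  congr Num.sqrt; under eq_bigr do rewrite mxE expr1n.
  by rewrite sumr_const card_ord.
apply: le_trans (ler_dot _ _); rewrite dotE big_ord_recl !mxE unlift_none mulr1.
by rewrite lerD2l; apply: ler_sum => i _; rewrite !mxE liftK mulr1.
Qed.

End StateNorm.

(** * The vector fields *)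

Section Fields.
Context {R : realType} {N k : nat}.
Implicit Types (x y u : 'cV[R]_N) (v w : 'I_k -> 'cV[R]_N).

Lemma sum_outerE v (P : pred 'I_k) u :
  (\sum_(j < k | P j) v j *m (v j)^T) *m u = \sum_(j < k | P j) dot (v j) u *: v j.
Proof. by rewrite mulmx_suml; apply: eq_bigr => j _; rewrite mulmx_outer. Qed.

Lemma l2norm_sum_outer_le v (P : pred 'I_k) u :
  l2norm ((\sum_(j < k | P j) v j *m (v j)^T) *m u)
    <= (\sum_(j < k) l2norm (v j) ^+ 2) * l2norm u.
Proof.
rewrite sum_outerE; apply: le_trans (ler_l2norm_sum _ _) _; rewrite mulr_suml.
rewrite big_mkcond; apply: ler_sum => j _; case: (P j); last first.
  by rewrite mulr_ge0 ?sqr_ge0 ?l2norm_ge0.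
rewrite l2normZ; have := ler_norm_dot (v j) u; have := l2norm_ge0 (v j); nra.
Qed.

(** The difference splits as [<v, u> (v - w) + <v - w, u> w]. *)
Lemma l2norm_outerB_le (a b u : 'cV[R]_N) :
  l2norm (dot a u *: a - dot b u *: b)
    <= (l2norm a + l2norm b) * l2norm (a - b) * l2norm u.
Proof.
have -> : dot a u *: a - dot b u *: b = dot a u *: (a - b) + dot (a - b) u *: b.
  by rewrite dotBl scalerBl scalerBr addrA subrK.
apply: le_trans (ler_l2normD _ _) _; rewrite !l2normZ.
have := ler_norm_dot a u; have := ler_norm_dot (a - b) u.
have := l2norm_ge0 (a - b); have := l2norm_ge0 b; nra.
Qed.

Lemma l2norm_x_field_le E x v :
  l2norm (x_field E x v)
    <= (1 + 2 * \sum_(j < k) l2norm (v j) ^+ 2) * l2norm (force E x).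
Proof.
rewrite /x_field mulmxBl mul1mx -scalemxAl.
apply: le_trans (ler_l2normB _ _) _; rewrite l2normZ ger0_norm //.
have := l2norm_sum_outer_le v xpredT (force E x); nra.
Qed.

Lemma l2norm_v_field_le E i x v l :
  l2norm (v_field E i x v l)
    <= (1 + l2norm (v i) ^+ 2 + 2 * \sum_(j < k) l2norm (v j) ^+ 2)
       * l2norm (dimer E x (v i) l).
Proof.
rewrite /v_field 2!mulmxBl mul1mx -scalemxAl mulmx_outer.
move: (dimer _ _ _ _) => d.
apply: le_trans (ler_l2normB _ _) _.
apply: le_trans (lerD (ler_l2normB _ _) (lexx _)) _.
rewrite !l2normZ (ger0_norm (ler0n R 2)).
have /= := l2norm_sum_outer_le v (fun j => (j < i)%N) d.
have h : `|dot (v i) d| * l2norm (v i) <= l2norm (v i) ^+ 2 * l2norm d.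
  by rewrite expr2 mulrAC ler_wpM2r ?l2norm_ge0 ?ler_norm_dot.
lra.
Qed.

Lemma l2norm_force_le E (L : R -> R) r x : locally_lipschitz E L -> 0 < r ->
  l2norm x <= r -> l2norm (force E x) <= l2norm (force E 0) + L r * r.
Proof.
move=> hL r0 xr; have [Lgt0 lip] := hL r r0.
have := (lip 0 x _ xr).1; rewrite l2norm0 subr0 => /(_ (ltW r0)) h.
rewrite -[force E x](subrK (force E 0)) addrC.
apply: le_trans (ler_l2normD _ _) _; rewrite lerD2l.
by apply: le_trans h _; rewrite ler_pM2l.
Qed.

(** [Q0_const] is a Lipschitz constant of the position field on the ball of
    radius [r]: the force is [L r]-Lipschitz and is multiplied by a matrix of norm
    at most [1 + 2 k r^2], while each [v_j v_j^T] varies by at most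
    [2 r |v_j - w_j|] and is applied to twice a force of norm at most
    [|F(0)| + L r * r]. The factor [sqrt (k + 1)] compares the sum of the
    component norms with the state norm. *)
Lemma x_field_lipschitz E (L : R -> R) r x y v w :
  locally_lipschitz E L -> 0 < r ->
  state_norm x v <= r -> state_norm y w <= r ->
  l2norm (x_field E x v - x_field E y w)
    <= Q0_const k E L r * state_norm (x - y) (fun j => v j - w j).
Proof.
move=> hL r0 xvr ywr.
have xr := le_trans (l2norm_pos_le_state_norm x v) xvr.
have yr := le_trans (l2norm_pos_le_state_norm y w) ywr.
have vr j := le_trans (l2norm_dir_le_state_norm x v j) xvr.
have wr j := le_trans (l2norm_dir_le_state_norm y w j) ywr.
have Fy := l2norm_force_le hL r0 yr.
have [Lgt0 lip] := hL r r0; have [Fxy _] := lip y x yr xr.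
set A := 1%:M - 2 *: \sum_(j < k) v j *m (v j)^T.
have -> : x_field E x v - x_field E y w =
    A *m (force E x - force E y)
    - 2 *: \sum_(j < k) (dot (v j) (force E y) *: v j
                        - dot (w j) (force E y) *: w j).
  rewrite /x_field mulmxBr -/A -[RHS]addrA; congr (_ + _).
  rewrite /A !mulmxBl !mul1mx -!scalemxAl !sum_outerE sumrB scalerBr.
  by rewrite !opprB [RHS]addrAC addrCA subrr addr0.
rewrite /Q0_const; set M := Num.max _ _.
have M1 : (1 + 2 * k%:R * r ^+ 2) * L r <= M by rewrite le_max lexx.
have M2 : 4 * r * (l2norm (force E 0) + L r * r) <= M by rewrite le_max lexx orbT.
have Mge0 : 0 <= M.
  by apply: le_trans M1; rewrite !mulr_ge0 ?addr_ge0 ?mulr_ge0 ?sqr_ge0 // ltW.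
rewrite (mulrC _ M) -mulrA.
apply: le_trans (ler_wpM2l Mge0 (sum_norm_le_state_norm _ _)).
rewrite mulrDr; apply: le_trans (ler_l2normB _ _) _; apply: lerD.
- rewrite /A mulmxBl mul1mx -scalemxAl; set f := force E x - force E y.
  apply: le_trans (ler_l2normB _ _) _; rewrite l2normZ ger0_norm //.
  have vsum : \sum_(j < k) l2norm (v j) ^+ 2 <= k%:R * r ^+ 2.
    rewrite mulr_natl -[k in _ *+ k]card_ord -sumr_const; apply: ler_sum => j _.
    by rewrite ler_pXn2r ?nnegrE ?l2norm_ge0 ?(ltW r0) ?vr.
  apply: le_trans (ler_wpM2r (l2norm_ge0 _) M1); rewrite -mulrA.
  have kr : 0 <= k%:R * r ^+ 2 by rewrite mulr_ge0 ?sqr_ge0.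
  have := l2norm_sum_outer_le v xpredT f; have := l2norm_ge0 f.
  move: Fxy; rewrite -/f; nra.
- rewrite l2normZ ger0_norm // mulr_sumr.
  apply: le_trans (ler_wpM2l _ (ler_l2norm_sum _ _)) _ => //.
  rewrite mulr_sumr; apply: ler_sum => j _.
  have := l2norm_outerB_le (v j) (w j) (force E y).
  set d := l2norm (v j - w j); have d0 : 0 <= d by exact: l2norm_ge0.
  set f := l2norm (force E y) in Fy *; have f0 : 0 <= f by exact: l2norm_ge0.
  set G := _ + _ * r in M2 Fy.
  have h1 : (l2norm (v j) + l2norm (w j)) * d * f <= 2 * r * d * G.
    have h0 : 0 <= l2norm (v j) + l2norm (w j) by rewrite addr_ge0 ?l2norm_ge0.
    rewrite ler_pM ?mulr_ge0 // ler_wpM2r //.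
    by have := vr j; have := wr j; lra.
  have h2 := ler_wpM2r d0 M2.
  lra.
Qed.

End Fields.

(** * Differential inequalities in one variable *)

Section Gronwall.
Context {R : realType}.
Implicit Types (w dw l : R -> R) (T Q c B s t : R).

Lemma is_derive_expR_lin (a t : R) :
  is_derive t 1 (expR \o (a \*: @idfun R)) (a * expR (a * t)).
Proof.
have -> : a * expR (a * t) = expR (a * t) * (a *: 1).
  by rewrite /GRing.scale /= mulr1 mulrC.
by apply: is_derive1_comp.
Qed.

Lemma within_continuousM (A : set R) (f g : R -> R) :
  {within A, continuous f} -> {within A, continuous g} ->
  {within A, continuous (f * g)}.
Proof. by move=> cf cg x; apply: continuousM; [exact: cf|exact: cg]. Qed.

Lemma is_derive_within_continuous (A : set R) (f df : R -> R) :
  (forall t, is_derive t 1 f (df t)) -> {within A, continuous f}.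
Proof.
move=> fd; apply: continuous_subspaceT => t.
by apply/differentiable_continuous/derivable1_diffP; have [] := fd t.
Qed.

(** The function [w t * exp (- Q t) - c t] is nonincreasing. *)
Lemma gronwall w dw Q c s : 0 <= Q -> 0 <= c -> 0 < s ->
  {within `[0, s], continuous w} ->
  (forall t, 0 < t -> t < s -> is_derive t 1 w (dw t)) ->
  (forall t, 0 < t -> t < s -> dw t <= Q * w t + c) ->
  w s <= (w 0 + c * s) * expR (Q * s).
Proof.
move=> Q0 c0 s0 cw w' dwle.
pose e := expR \o (- Q \*: @idfun R).
have [||t] := @MVT R (w * e - c \*: @idfun R)
    (fun t => w t *: (- Q * expR (- Q * t)) + e t *: dw t - c *: 1) 0 s s0.
- move=> t; rewrite in_itv /= => /andP[t0 ts].
  have wt := w' t t0 ts; have et := is_derive_expR_lin (- Q) t.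
  exact: is_deriveB.
- apply: within_continuousB.
    apply: within_continuousM => //.
    by apply: is_derive_within_continuous => t; exact: is_derive_expR_lin.
  exact: (@is_derive_within_continuous _ _ (fun=> c *: 1)).
rewrite in_itv /= => /andP[t0 ts].
rewrite -![(_ - _ : _ -> _) _]/(_ - _) -![(_ * _ : _ -> _) _]/(_ * _) /e /=.
rewrite /GRing.scale /= !mulr0 expR0 !mulr1 !subr0 => h.
have := dwle t t0 ts; have e0 := expR_gt0 (- Q * t).
have e1 : expR (- Q * t) <= 1.
  by rewrite -expR0 ler_expR mulNr oppr_le0 mulr_ge0 ?(ltW t0).
move=> {}dwle.
have {h} : w s * expR (- Q * s) - c * s - w 0 <= 0.
  rewrite h mulrC; apply: mulr_ge0_le0 (ltW s0) _.
  set x := expR _ in e0 e1 *.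
  have : x * dw t <= x * (Q * w t + c) by rewrite ler_pM2l.
  have : x * c <= c by rewrite ler_piMl.
  lra.
rewrite mulNr expRN => h.
rewrite -ler_pdivrMr ?expR_gt0 //; lra.
Qed.

(** The derivative of [l t * exp t] vanishes. *)
Lemma exp_decay_bounds l (l0 : R) T : 0 < l0 -> {within `[0, T], continuous l} ->
  l 0 = l0 -> (forall t, 0 < t -> t < T -> is_derive t 1 l (- l t)) ->
  forall t, 0 < t -> t < T -> 0 < l t <= l0.
Proof.
move=> l00 cl ll0 l' s s0 sT.
pose e := expR \o (1 \*: @idfun R).
have [||t] := @MVT R (l * e)
    (fun t => l t *: (1 * expR (1 * t)) + e t *: (- l t)) 0 s s0.
- move=> t; rewrite in_itv /= => /andP[t0 ts].
  have lt := l' t t0 (lt_trans ts sT); have et := is_derive_expR_lin 1 t.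
  exact: is_deriveM.
- apply: within_continuousM.
    by apply: (continuous_subspaceW _ cl); apply: subset_itvl; rewrite bnd_simp ltW.
  by apply: is_derive_within_continuous => t; exact: is_derive_expR_lin.
move=> _; rewrite -![(_ * _ : _ -> _) _]/(_ * _) /e /= /GRing.scale /=.
rewrite !mul1r expR0 mulr1 ll0 mulrN (mulrC (expR t)) subrr mul0r.
move=> /eqP; rewrite subr_eq0 => /eqP h.
have e1 : 1 <= expR s by rewrite -expR0 ler_expR ltW.
have ls : 0 < l s by rewrite -(pmulr_lgt0 _ (expR_gt0 s)) h.
by rewrite ls -h ler_peMr // ltW.
Qed.

(** If the differential inequality is known only below the level [B], but the
    bound that it yields stays below [B], then [B] is never crossed: at the first
    time [s] where [w] reaches [B], the bound on [w s] is below [B] unless [s] is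
    the final time. *)
Lemma gronwall_bootstrap w dw Q c B T : 0 < Q -> 0 <= c -> 0 < w 0 ->
  {within `[0, T], continuous w} ->
  (forall t, 0 < t -> t < T -> is_derive t 1 w (dw t)) ->
  (forall t, 0 < t -> t < T -> w t <= B -> dw t <= Q * w t + c) ->
  (w 0 + c * T) * expR (Q * T) <= B ->
  forall t, 0 <= t <= T -> w t <= B.
Proof.
move=> Q0 c0 w0 cw w' dwle leB t /andP[t0 tT].
have [//|ltBw] := leP (w t) B; exfalso.
(* Strictness comes from [0 < w 0] and [0 < Q]. *)
have bound_mono a b : 0 <= a -> a < b ->
    (w 0 + c * a) * expR (Q * a) < (w 0 + c * b) * expR (Q * b).
  move=> a0 ab; have ea := expR_gt0 (Q * a).
  have eab : expR (Q * a) < expR (Q * b) by rewrite ltr_expR ltr_pM2l.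
  have cab : c * a <= c * b by rewrite ler_wpM2l // ltW.
  have wa : 0 < w 0 + c * a by rewrite ltr_wpDr // mulr_ge0.
  nra.
have T0 : 0 <= T := le_trans t0 tT.
have w0B : w 0 < B.
  have := bound_mono 0 T (lexx _); rewrite !mulr0 expR0 mulr1 addr0 => h.
  have := T0; rewrite le_eqVlt => /orP[/eqP T0'|/h /lt_le_trans -> //].
  have te : t = 0 by apply/eqP; rewrite eq_le t0 T0' tT.
  move: leB ltBw; rewrite -T0' te !mulr0 expR0 mulr1 addr0.
  by move=> /le_lt_trans /[apply]; rewrite ltxx.
(* [w] is continuous only on [[0, T]], so the superlevel set is closed in the
   subspace topology; it is the trace of a closed set of the line. *)
have [V cV VE] : exists2 V, closed (V : set R) &
    V `&` `[0, T] = [set t | B <= w t] `&` `[0, T].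
  apply/closed_subspaceP.
  apply: (@closed_comp (subspace `[0, T]) R w [set y | B <= y]).
    by move=> x _; exact: cw.
  exact: closed_ge.
have cA : compact ([set t | B <= w t] `&` `[0, T]).
  by rewrite -VE setIC; apply: compact_closedI => //; exact: segment_compact.
have [|s /set_mem [/= Bws]] := compact_EVT_min _ cA
    (@continuous_subspaceT _ _ _ (@idfun R) (fun=> cvg_id)).
  by exists t; split; rewrite /= ?ltW // in_itv /= t0.
rewrite in_itv /= => /andP[s0 sT] smin.
have st : s <= t by apply: smin; rewrite inE; split; rewrite /= ?ltW // in_itv /= t0.
have wltB r : 0 < r -> r < s -> w r < B.
  move=> r0 rs; rewrite ltNge; apply/negP => Bwr.
  have : s <= r.
    apply: smin; rewrite inE; split; rewrite //= in_itv /= (ltW r0).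
    exact: le_trans (ltW rs) sT.
  by rewrite leNgt rs.
have sgt0 : 0 < s.
  rewrite lt0r s0 andbT; apply: contraTneq Bws => ->; by rewrite -ltNge.
have ws : w s <= (w 0 + c * s) * expR (Q * s).
  apply: (gronwall (ltW Q0) c0 sgt0 (dw := dw)).
  - by apply: (continuous_subspaceW _ cw); apply: subset_itvl; rewrite bnd_simp.
  - by move=> r r0 rs; apply: w' => //; exact: lt_le_trans rs sT.
  - move=> r r0 rs; apply: dwle => //; first exact: lt_le_trans rs sT.
    exact: ltW (wltB r r0 rs).
have := sT; rewrite le_eqVlt => /orP[/eqP se|/(bound_mono s T s0) h]; last first.
  by have := lt_le_trans (le_lt_trans (le_trans Bws ws) h) leB; rewrite ltxx.
have te : t = s by apply/eqP; rewrite eq_le st andbT se.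
by move: ltBw; rewrite te ltNge (le_trans ws) // se.
Qed.

End Gronwall.

(** * Differentiating the Euclidean norm along a curve *)

Section NormCurve.
Context {R : realType} {N : nat}.
Implicit Types x : R -> 'cV[R]_N.

Lemma sqr_l2norm_fctE x :
  (fun s => l2norm (x s) ^+ 2) = \sum_(i < N) (fun s => x s i 0) ^+ 2.
Proof.
apply/funext => s; rewrite sqr_l2norm dotE fct_sumE.
by apply: eq_bigr => i _; rewrite -expr2.
Qed.

Lemma is_derive_sqr_l2norm x (dx : 'cV[R]_N) (t : R) : is_derive t 1 x dx ->
  is_derive t 1 (fun s => l2norm (x s) ^+ 2) (2 * dot (x t) dx).
Proof.
move=> [xd xdE]; rewrite sqr_l2norm_fctE.
have xi i : is_derive t 1 (fun s => x s i 0) (dx i 0).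
  have := (derivable_mxP _ _ _).1 xd i 0 => dxi.
  by apply: DeriveDef => //; rewrite -xdE derive_mx // mxE.
apply: (is_derive_eq (is_derive_sum (fun i => is_deriveX 2 (xi i)))).
by rewrite dotE mulr_sumr; apply: eq_bigr => i _; rewrite /GRing.scale /= -mulrA.
Qed.

Lemma within_continuous_sqr_l2norm (A : set R) x : {within A, continuous x} ->
  {within A, continuous (fun s => l2norm (x s) ^+ 2)}.
Proof.
move=> cx; rewrite sqr_l2norm_fctE.
elim/big_ind : _ => [||i _].
- exact: (continuous_subspaceT (fun=> cvg_cst _)).
- by move=> f g; exact: within_continuousD.
have cxi : {within A, continuous (fun s => x s i 0)}.
  move=> s; apply: (@continuous_comp (subspace A) _ _ x (fun M => M i 0)).
    exact: cx.
  exact: coord_continuous.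
by rewrite expr2; apply: within_continuousM.
Qed.

End NormCurve.

Section Trajectory.
Context {R : realType} {N k : nat}.
Implicit Types (x : R -> 'cV[R]_N) (v : R -> 'I_k -> 'cV[R]_N).

Lemma sqr_state_norm_fctE x v :
  (fun t => state_norm (x t) (v t) ^+ 2) =
  (fun t => l2norm (x t) ^+ 2) + \sum_(j < k) (fun t => l2norm (v t j) ^+ 2).
Proof. by apply/funext => t; rewrite sqr_state_norm fctE fct_sumE. Qed.

Lemma is_derive_sqr_state_norm x v (t : R) (dx : 'cV[R]_N)
    (dv : 'I_k -> 'cV[R]_N) :
  is_derive t 1 x dx -> (forall j, is_derive t 1 (fun s => v s j) (dv j)) ->
  is_derive t 1 (fun s => state_norm (x s) (v s) ^+ 2)
    (2 * dot (x t) dx + \sum_(j < k) 2 * dot (v t j) (dv j)).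
Proof.
move=> /is_derive_sqr_l2norm xd vd; rewrite sqr_state_norm_fctE.
apply: is_deriveD; apply: is_derive_sum => j.
exact: (is_derive_sqr_l2norm (vd j)).
Qed.

Lemma within_continuous_sqr_state_norm (A : set R) x v :
  {within A, continuous x} -> (forall j, {within A, continuous (fun t => v t j)}) ->
  {within A, continuous (fun t => state_norm (x t) (v t) ^+ 2)}.
Proof.
move=> cx cv; rewrite sqr_state_norm_fctE.
apply: within_continuousD; first exact: within_continuous_sqr_l2norm.
elim/big_ind : _ => [||j _].
- exact: (continuous_subspaceT (fun=> cvg_cst _)).
- by move=> f g; exact: within_continuousD.
- exact: within_continuous_sqr_l2norm.
Qed.

End Trajectory.

(** * Energy estimate *)

Section Energy.
Context {R : realType} {N k : nat}.
Implicit Types (x y : 'cV[R]_N) (v w : 'I_k -> 'cV[R]_N).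

Lemma Q0_const_ge0 (E : 'cV[R]_N -> R) (L : R -> R) r :
  locally_lipschitz E L -> 0 < r -> 0 <= Q0_const k E L r.
Proof.
move=> hL r0; have [Lgt0 _] := hL r r0.
rewrite mulr_ge0 ?sqrtr_ge0 // le_max; apply/orP; left.
by rewrite mulr_ge0 ?addr_ge0 ?mulr_ge0 ?sqr_ge0 // ltW.
Qed.

(** The Lipschitz estimate is applied between the current and the initial state,
    whose distance is at most [state_norm x v + r]. *)
Lemma x_field_growth E (L : R -> R) r x0 v0 x v : (0 < k)%N ->
  locally_lipschitz E L -> 0 < r ->
  state_norm x0 v0 <= r -> state_norm x v <= r ->
  l2norm (x_field E x v)
    <= Q3_const E x0 v0 + Q0_const k E L r * r
       + Q0_const k E L r * state_norm x v.
Proof.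
move=> k0 hL r0 h0 h.
have Q0ge0 := Q0_const_ge0 hL r0.
have lip := x_field_lipschitz hL r0 h h0.
have {lip} lip : l2norm (x_field E x v - x_field E x0 v0)
    <= Q0_const k E L r * (state_norm x v + r).
  apply: le_trans lip _; apply: ler_wpM2l => //.
  by apply: le_trans (ler_state_normB _ _ _ _) _; rewrite lerD2l.
have base : l2norm (x_field E x0 v0) <= Q3_const E x0 v0.
  apply: le_trans (l2norm_x_field_le E x0 v0) _.
  apply: ler_wpM2r (l2norm_ge0 _) _ _ _.
  rewrite lerD2l -mulrA ler_pM2l // ler_peMl ?ler1n //.
  by apply: sumr_ge0 => j _; rewrite sqr_ge0.
rewrite -[x_field E x v](subrK (x_field E x0 v0)).
apply: le_trans (ler_l2normD _ _) _; lra.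
Qed.

(** Same comparison with the initial state, at the same dimer length [l]. At the
    initial state the dimer is within [Q1 r * l0^2] of the Hessian applied to
    [v0 i], which gives [Q4_const]. *)
Lemma v_field_growth E (Q1 Q2 : R -> R) (l0 l r : R) x0 v0 x v i :
  dimer_consistent E l0 Q1 -> v_field_lipschitz k E l0 Q2 r -> 0 < r ->
  state_norm x0 v0 <= r -> state_norm x v <= r -> 0 < l -> l <= l0 ->
  l2norm (v_field E i x v l)
    <= Q4_const E l0 Q1 x0 v0 i r + Q2 r * r + Q2 r * l0 ^+ 2
       + Q2 r * state_norm x v.
Proof.
move=> hQ1 [Q2gt0 hQ2] r0 h0 h lgt0 ll0.
have {hQ2} lip : l2norm (v_field E i x v l - v_field E i x0 v0 l)
    <= Q2 r * (state_norm x v + r + l0 ^+ 2).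
  apply: le_trans (hQ2 i x x0 v v0 l h h0 lgt0 ll0) _.
  rewrite ler_pM2l // lerD2r; apply: le_trans (ler_state_normB _ _ _ _) _.
  by rewrite lerD2l.
have [Q1gt0 cons] := hQ1 r r0.
have x0r := le_trans (l2norm_pos_le_state_norm x0 v0) h0.
have v0r := le_trans (l2norm_dir_le_state_norm x0 v0 i) h0.
have dim : l2norm (dimer E x0 (v0 i) l)
    <= opnorm (neg_hessian E x0) * l2norm (v0 i) + Q1 r * l0 ^+ 2.
  rewrite -[dimer _ _ _ _](subrK (neg_hessian E x0 *m v0 i)) addrC.
  apply: le_trans (ler_l2normD _ _) _.
  apply: lerD; first exact: l2norm_mulmx_le_opnorm.
  apply: le_trans (cons x0 (v0 i) l x0r v0r lgt0 ll0) _.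
  by rewrite ler_pM2l // ler_pXn2r // nnegrE ltW // (lt_le_trans lgt0).
have base : l2norm (v_field E i x0 v0 l) <= Q4_const E l0 Q1 x0 v0 i r.
  apply: le_trans (l2norm_v_field_le E i x0 v0 l) _.
  have S0 : 0 <= \sum_(j < k) l2norm (v0 j) ^+ 2.
    by apply: sumr_ge0 => j _; rewrite sqr_ge0.
  apply: ler_pM => //; rewrite ?l2norm_ge0 ?addr_ge0 ?sqr_ge0 ?mulr_ge0 //.
  rewrite lerD2l -mulrA ler_pM2l // ler_peMl // ler1n.
  exact: leq_ltn_trans (leq0n i) (ltn_ord i).
rewrite -[v_field E i x v l](subrK (v_field E i x0 v0 l)).
apply: le_trans (ler_l2normD _ _) _; lra.
Qed.

(** Young's inequality on each of the two terms of [2 |u| (p + q W)]. *)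
Lemma growth_dot_le (u f : 'cV[R]_N) (a p q W : R) :
  0 <= a -> 0 <= q -> l2norm f <= p + q * W ->
  2 * dot u (a *: f)
    <= a * (1 + q) * l2norm u ^+ 2 + a * q * W ^+ 2 + a * p ^+ 2.
Proof.
move=> a0 q0 fle; rewrite dotZr mulrCA.
have -> : a * (1 + q) * l2norm u ^+ 2 + a * q * W ^+ 2 + a * p ^+ 2 =
  a * ((1 + q) * l2norm u ^+ 2 + q * W ^+ 2 + p ^+ 2) by ring.
apply: ler_wpM2l => //.
have h : dot u f <= l2norm u * (p + q * W).
  by apply: le_trans (ler_dot u f) _; rewrite ler_wpM2l ?l2norm_ge0.
have h1 := sqr_ge0 (l2norm u - p).
have h2 : 0 <= q * (l2norm u - W) ^+ 2 by rewrite mulr_ge0 ?sqr_ge0.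
lra.
Qed.

(** Young's inequality leaves the coefficient [b (1 + q)] on [|x|^2] and
    [g (1 + q')] on each [|v_j|^2]; the maximum of the two bounds both by a
    multiple of the squared state norm. *)
Lemma energy_le x v (X : 'cV[R]_N) (V : 'I_k -> 'cV[R]_N) (b g p q p' q' : R) :
  0 <= b -> 0 <= g -> 0 <= q -> 0 <= q' ->
  l2norm X <= p + q * state_norm x v ->
  (forall j, l2norm (V j) <= p' + q' * state_norm x v) ->
  2 * dot x (b *: X) + \sum_(j < k) 2 * dot (v j) (g *: V j)
    <= (Num.max (b * (1 + q)) (g * (1 + q')) + b * q + k%:R * g * q')
         * state_norm x v ^+ 2 + (b * p ^+ 2 + k%:R * g * p' ^+ 2).
Proof.
move=> b0 g0 q0 q'0 hX hV; set W := state_norm x v in hX hV *.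
have hx := growth_dot_le x b0 q0 hX.
have hv : \sum_(j < k) 2 * dot (v j) (g *: V j) <=
    g * (1 + q') * \sum_(j < k) l2norm (v j) ^+ 2
    + k%:R * (g * q' * W ^+ 2 + g * p' ^+ 2).
  have -> : k%:R * (g * q' * W ^+ 2 + g * p' ^+ 2) =
      \sum_(j < k) (g * q' * W ^+ 2 + g * p' ^+ 2).
    by rewrite sumr_const card_ord mulr_natl.
  rewrite mulr_sumr -big_split /=.
  by apply: ler_sum => j _; rewrite addrA; exact: growth_dot_le.
set M := Num.max _ _.
have M1 : b * (1 + q) * l2norm x ^+ 2 <= M * l2norm x ^+ 2.
  by rewrite ler_wpM2r ?sqr_ge0 // le_max lexx.
have M2 : g * (1 + q') * (\sum_(j < k) l2norm (v j) ^+ 2) <=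
    M * \sum_(j < k) l2norm (v j) ^+ 2.
  rewrite ler_wpM2r ?le_max ?lexx ?orbT //.
  by apply: sumr_ge0 => j _; rewrite sqr_ge0.
have WE : M * W ^+ 2 = M * l2norm x ^+ 2 + M * \sum_(j < k) l2norm (v j) ^+ 2.
  by rewrite /W sqr_state_norm mulrDr.
lra.
Qed.

End Energy.

(** * The trajectory stays in the ball *)

Theorem theorem2p2 (R : realType) (N k : nat) (hN : (1 <= N)%N) (hk : (1 <= k)%N)
    (T l0 : R) (hT : 0 < T) (hl0 : 0 < l0)
    (E : 'cV[R]_N -> R) (hE : twice_differentiable E)
    (L : R -> R) (hL : locally_lipschitz E L)
    (Q1 : R -> R) (hQ1 : dimer_consistent E l0 Q1)
    (x0 : 'cV[R]_N) (v0 : 'I_k -> 'cV[R]_N)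
    (hv0 : forall i j : 'I_k, ((v0 i)^T *m v0 j) 0 0 = (i == j)%:R)
    (eps0 r0 : R) (heps0 : 0 < eps0) (hr0 : state_norm x0 v0 + eps0 <= r0)
    (Q2 : R -> R) (hQ2 : v_field_lipschitz k E l0 Q2 r0)
    (beta gamma : R) (hbeta : 0 < beta) (hgamma : 0 < gamma)
    (i : 'I_k)
    (hS : S_const E T l0 L Q1 Q2 x0 v0 i r0 beta gamma
          <= state_norm x0 v0 + eps0)
    (x : R -> 'cV[R]_N) (v : R -> 'I_k -> 'cV[R]_N) (l : R -> R)
    (hsol : saddle_dynamics E T l0 beta gamma x0 v0 x v l) :
  [/\ forall t : R, 0 <= t <= T -> state_norm (x t) (v t) <= state_norm x0 v0 + eps0,
      forall t : R, 0 <= t <= T -> l2norm (x t) <= r0 &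
      forall s t : R, 0 <= s <= T -> 0 <= t <= T ->
        l2norm (force E (x t) - force E (x s)) <= L r0 * l2norm (x t - x s) /\
        opnorm (neg_hessian E (x t) - neg_hessian E (x s))
          <= L r0 * l2norm (x t - x s)].
Proof.
have [[cx cv cl] [x_0 v_0 l_0] ode] := hsol.
set rho := state_norm x0 v0 + eps0 in hr0 hS *.
have s0 : 0 <= state_norm x0 v0 := state_norm_ge0 x0 v0.
have rho0 : 0 < rho by rewrite ltr_wpDl.
have r00 : 0 < r0 := lt_le_trans rho0 hr0.
have s0r0 : state_norm x0 v0 <= r0 by apply: le_trans hr0; rewrite lerDl ltW.
have v0_unit j : l2norm (v0 j) = 1.
  apply/eqP; rewrite -(@eqrXn2 _ 2) ?l2norm_ge0 //.
  by rewrite sqr_l2norm /dot hv0 eqxx expr1n.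
have Q2gt0 : 0 < Q2 r0 by case: hQ2.
have /andP[/andP[b0 g0] Q2ge0] : (0 <= beta) && (0 <= gamma) && (0 <= Q2 r0).
  by rewrite !ltW.
have Q0ge0 : 0 <= Q0_const k E L r0 := Q0_const_ge0 hL r00.
have lb : forall t, 0 < t -> t < T -> 0 < l t <= l0.
  apply: (exp_decay_bounds hl0 cl l_0) => t t0 tT.
  by case: (ode t t0 tT).
pose Q6 := Q6_const k E L Q2 r0 beta gamma.
pose Q5 := Q5_const E T l0 L Q1 Q2 x0 v0 i r0 beta gamma.
have Q6gt0 : 0 < Q6.
  rewrite /Q6 /Q6_const -addrA ltr_pwDl //.
    by rewrite lt_max mulr_gt0 // ltr_wpDr.
  by rewrite addr_ge0 ?(mulr_ge0 b0 Q0ge0) ?mulr_ge0.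
have Q5T : Q5 / T = beta * (Q3_const E x0 v0 + Q0_const k E L r0 * r0) ^+ 2 +
    k%:R * gamma *
    (Q4_const E l0 Q1 x0 v0 i r0 + Q2 r0 * r0 + Q2 r0 * l0 ^+ 2) ^+ 2.
  by rewrite /Q5 /Q5_const; field; rewrite gt_eqF.
have Q5Tge0 : 0 <= Q5 / T.
  rewrite Q5T; apply: addr_ge0; apply: mulr_ge0; by rewrite ?sqr_ge0 ?mulr_ge0.
(* The hypothesis on the parameters mentions one index [i], while the field of
   every direction has to be bounded. *)
have Q4E j : Q4_const E l0 Q1 x0 v0 j r0 = Q4_const E l0 Q1 x0 v0 i r0.
  by rewrite /Q4_const !v0_unit.
have bound t : 0 <= t <= T -> state_norm (x t) (v t) <= rho.
  move=> tT; rewrite -(@ler_pXn2r _ 2) ?nnegrE ?state_norm_ge0 ?(ltW rho0) //.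
  move: t tT; apply: (gronwall_bootstrap
    (w := fun t => state_norm (x t) (v t) ^+ 2) (Q := Q6) (c := Q5 / T)
    (dw := fun t => 2 * dot (x t) (beta *: x_field E (x t) (v t)) +
      \sum_(j < k) 2 * dot (v t j) (gamma *: v_field E j (x t) (v t) (l t)))) => //.
  - rewrite x_0 (_ : v 0 = v0) ?exprn_gt0 //; last exact/funext.
    apply: lt_le_trans (l2norm_dir_le_state_norm x0 v0 i).
    by rewrite v0_unit.
  - exact: within_continuous_sqr_state_norm.
  - move=> t t0 tT; have [xd vd _] := ode t t0 tT.
    exact: is_derive_sqr_state_norm.
  - move=> t t0 tT wB; have /andP[lt0 ltl0] := lb t t0 tT.
    have {wB} Wr : state_norm (x t) (v t) <= r0.
      apply: le_trans hr0.
      by rewrite -(@ler_pXn2r _ 2) ?nnegrE ?state_norm_ge0 // ltW.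
    rewrite Q5T; apply: energy_le => //; try exact: ltW.
      exact: x_field_growth.
    by move=> j; rewrite -(Q4E j); exact: v_field_growth.
  - rewrite x_0 (_ : v 0 = v0); last exact/funext.
    rewrite divfK ?gt_eqF //.
    have S0 : 0 <= S_const E T l0 L Q1 Q2 x0 v0 i r0 beta gamma.
      by rewrite mulr_ge0 ?sqrtr_ge0 ?expR_ge0.
    have Q5ge0 : 0 <= Q5 by rewrite -(divfK (lt0r_neq0 hT) Q5) mulr_ge0 // ltW.
    have -> : (state_norm x0 v0 ^+ 2 + Q5) * expR (Q6 * T) =
        S_const E T l0 L Q1 Q2 x0 v0 i r0 beta gamma ^+ 2.
      rewrite /S_const exprMn (sqr_sqrtr (addr_ge0 (sqr_ge0 _) Q5ge0)).
      by congr (_ * _); rewrite [RHS]expr2 -expRD -splitr.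
    by rewrite ler_pXn2r ?nnegrE // ltW.
have xr t : 0 <= t <= T -> l2norm (x t) <= r0.
  move=> /bound h; apply: le_trans hr0; apply: le_trans h.
  exact: l2norm_pos_le_state_norm.
split=> // s t sT tT.
by have [_ lip] := hL r0 r00; apply: lip; exact: xr.
Qed.
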